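(* Let $T$ be a countable set of transitions, let $\mathcal{H}$ be the set of all finite sequences over $T$ (including the empty sequence $\varepsilon$), and let $\succsim$ be a binary relation on $\Delta(\mathcal{H})$. The following are equivalent: (i) $\succsim$ satisfies Completeness, Transitivity, Independence, Continuity, and Temporal $\gamma$-Indifference with $\gamma(t) = 1$ for all $t \in T$; (ii) $\succsim$ satisfies Completeness, Transitivity, Independence, Continuity, and Additivity: for all $h_1, h_2 \in \mathcal{H}$, $A, B, C, D \in \Delta(\mathcal{H})$ and $p \in [0,1]$, $$p(h_1 \cdot A) + (1-p) C \succsim p(h_1 \cdot B) + (1-p) D \iff p(h_2 \cdot A) + (1-p) C \succsim p(h_2 \cdot B) + (1-p) D.$$
   Context: $\Delta(\mathcal{H})$ is the set of finitely supported probability distributions on $\mathcal{H}$; a history $h\in\mathcal{H}$ is identified with the Dirac distribution at $h$. For $A,B\in\Delta(\mathcal{H})$ and $p\in[0,1]$, $pA+(1-p)B$ is the mixture. For histories $g,h\in\mathcal{H}$, $g\cdot h$ is the concatenation ($g$ first), with $\varepsilon\cdot h = h$; for $A\in\Delta(\mathcal{H})$, $g\cdot A$ is the distribution of $g\cdot h$ with $h$ sampled from $A$; a transition $t\in T$ is regarded as a history of length one. Write $A\sim B$ when $A\succsim B$ and $B\succsim A$. The axioms on $\succsim$ are: (1) Completeness: for all $A,B\in\Delta(\mathcal{H})$, $A\succsim B$ or $B\succsim A$. (2) Transitivity: for all $A,B,C \in \Delta(\mathcal{H})$, $A\succsim B\succsim C$ implies $A\succsim C$. (3) Independence: for all $A,B,C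 \in \Delta(\mathcal{H})$ and $p\in(0,1)$, $A\succsim B$ if and only if $pA+(1-p)C\succsim pB+(1-p)C$. (4) Continuity: for all $A,B,C \in \Delta(\mathcal{H})$, if $A\succsim B\succsim C$ then there exists $p\in[0,1]$ such that $pA+(1-p)C\sim B$. (5) Temporal $\gamma$-Indifference, for a function $\gamma: T\to[0,1]$: for all $A,B\in\Delta(\mathcal{H})$ and $t\in T$, $$\tfrac{1}{\gamma(t)+1}(t\cdot A)+\tfrac{\gamma(t)}{\gamma(t)+1}B\sim\tfrac{1}{\gamma(t)+1}(t\cdot B)+\tfrac{\gamma(t)}{\gamma(t)+1}A.$$ *)

(* Defs.v *)
From HB Require Import structures.
From mathcomp Require Import all_boot all_order all_algebra finmap.
From mathcomp Require Import interval_inference mathcomp_extra reals convex.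

Set Implicit Arguments.
Unset Strict Implicit.
Unset Printing Implicit Defensive.

Import Order.TTheory GRing.Theory Num.Theory.

Local Open Scope fset_scope.
Local Open Scope ring_scope.
Local Open Scope convex_scope.

Section FiniteDistributions.
Context {R : realType} {H : choiceType}.

Definition is_fdist (f : {fsfun H -> R with 0}) : bool :=
  all (fun x => 0 <= f x) (finsupp f) && (\sum_(x <- finsupp f) f x == 1).

(* The conditions are boolean, so two distributions with the same values are
   equal, see fdistP. *)
Record fdist := FDist {
  fdist_val :> {fsfun H -> R with 0};
  _ : is_fdist fdist_val
}.

HB.instance Definition _ := [isSub for fdist_val].
HB.instance Definition _ := [Choice of fdist by <:].

Implicit Types (A B C : fdist) (p q r s : {i01 R}).

Lemma fdist_ge0 A x : 0 <= A x.
Proof.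
case: A => f /= /andP[/allP f0 _].
by case: finsuppP => // xf; exact: f0.
Qed.

Lemma fdist_sum1 A (S : {fset H}) :
  finsupp A `<=` S -> \sum_(x <- S) A x = 1.
Proof.
case: A => f /= /andP[_ /eqP f1] sub; rewrite -f1; apply/esym.
by apply: big_fset_incl => // x _ /fsfun_dflt.
Qed.

Lemma is_fdistI (f : {fsfun H -> R with 0}) (S : {fset H}) :
  finsupp f `<=` S -> (forall x, 0 <= f x) -> \sum_(x <- S) f x = 1 ->
  is_fdist f.
Proof.
move=> sub f0 f1; apply/andP; split; first by apply/allP => x _; exact: f0.
by rewrite -f1; apply/eqP/big_fset_incl => // x _ /fsfun_dflt.
Qed.

Lemma fdistP A B : A =1 B <-> A = B.
Proof. by split=> [/fsfunP AB|->//]; apply/val_inj. Qed.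

Definition fdist_mix_fun p A B : {fsfun H -> R with 0} :=
  [fsfun x in finsupp A `|` finsupp B => p%:num * A x + (1 - p%:num) * B x].

Lemma fdist_mix_funE p A B x :
  fdist_mix_fun p A B x = p%:num * A x + (1 - p%:num) * B x.
Proof.
rewrite fsfunE in_fsetU; case: ifPn => //.
by rewrite negb_or => /andP[/fsfun_dflt-> /fsfun_dflt->]; rewrite !mulr0 addr0.
Qed.

Fact fdist_mix_subproof p A B : is_fdist (fdist_mix_fun p A B).
Proof.
apply: (@is_fdistI _ (finsupp A `|` finsupp B)); first exact: finsupp_sub.
  move=> x; rewrite fdist_mix_funE addr_ge0 ?mulr_ge0 ?fdist_ge0//.
under eq_bigr do rewrite fdist_mix_funE.
rewrite big_split /= -!mulr_sumr !fdist_sum1 ?fsubsetUl ?fsubsetUr//.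
by rewrite !mulr1 addrC subrK.
Qed.

Definition fdist_mix p A B : fdist := FDist (fdist_mix_subproof p A B).

Lemma fdist_mixE p A B x :
  fdist_mix p A B x = p%:num * A x + (1 - p%:num) * B x.
Proof. exact: fdist_mix_funE. Qed.

Fact fdist_mix1 A B : fdist_mix 1%:i01 A B = A.
Proof. by apply/fdistP => x; rewrite fdist_mixE/= subrr mul1r mul0r addr0. Qed.

Fact fdist_mixmm p A : fdist_mix p A A = A.
Proof. by apply/fdistP => x; rewrite fdist_mixE -mulrDl addrC subrK mul1r. Qed.

Fact fdist_mixC p A B :
  fdist_mix p A B = fdist_mix (1 - p%:inum)%:i01 B A.
Proof. by apply/fdistP => x; rewrite !fdist_mixE/= subKr addrC. Qed.

Fact fdist_mixA : convex_quasi_associative fdist_mix.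
Proof.
move=> p q r s A B C prs spq; apply/fdistP => x; rewrite !fdist_mixE.
rewrite !mulrDr !mulrA addrA prs (mulrC s%:num); congr (_ + _ + _).
  by rewrite -(ConvexQuasiAssoc.pq_sr prs spq) prs.
by congr (_ * _); rewrite -prs -[LHS]spq.
Qed.

(* A <| p |> B is the mixture p A + (1 - p) B *)
HB.instance Definition _ :=
  isConvexSpace.Build R fdist fdist_mix1 fdist_mixmm fdist_mixC fdist_mixA.

Lemma fdist_convE p A B x :
  (A <| p |> B) x = p%:num * A x + (1 - p%:num) * B x.
Proof. exact: fdist_mixE. Qed.

End FiniteDistributions.

Arguments fdist : clear implicits.

Section Pushforward.
Context {R : realType} {H K : choiceType}.
Implicit Types (f : H -> K) (A : fdist R H).

Definition fdist_map_fun f A : {fsfun K -> R with 0} :=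
  [fsfun y in [fset f x | x in finsupp A] =>
     \sum_(x <- finsupp A | f x == y) A x].

Lemma fdist_map_funE f A y :
  fdist_map_fun f A y = \sum_(x <- finsupp A | f x == y) A x.
Proof.
rewrite fsfunE; case: ifPn => // yNf; rewrite big_seq_cond big1// => x.
by move=> /andP[xA /eqP fxy]; move: yNf; rewrite -fxy in_imfset.
Qed.

Fact fdist_map_subproof f A : is_fdist (fdist_map_fun f A).
Proof.
apply: (@is_fdistI _ _ _ [fset f x | x in finsupp A]).
- exact: finsupp_sub.
- by move=> y; rewrite fdist_map_funE sumr_ge0// => x _; exact: fdist_ge0.
under eq_bigr do rewrite fdist_map_funE.
by rewrite -partition_big_imfset/= fdist_sum1.
Qed.

(* the law of f x for x sampled from A *)
Definition fdist_map f A : fdist R K := FDist (fdist_map_subproof f A).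

Lemma fdist_mapE f A y :
  fdist_map f A y = \sum_(x <- finsupp A | f x == y) A x.
Proof. exact: fdist_map_funE. Qed.

End Pushforward.

Section Preferences.
Context {R : realType} {T : countType}.

Local Notation history := (seq T).
Local Notation lottery := (fdist R history).

Definition prepend (g : history) (A : lottery) : lottery :=
  fdist_map (fun h => g ++ h) A.

Variable pref : lottery -> lottery -> Prop.

Definition indiff (A B : lottery) : Prop := pref A B /\ pref B A.

Definition completeness : Prop := forall A B, pref A B \/ pref B A.

Definition transitivity : Prop :=
  forall A B C, pref A B -> pref B C -> pref A C.

Definition independence : Prop :=
  forall (A B C : lottery) (p : {i01 R}), 0 < p%:num < 1 ->
    pref A B <-> pref (A <| p |> C) (B <| p |> C).

Definition continuity : Prop :=
  forall A B C : lottery, pref A B -> pref B C ->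
    exists p : {i01 R}, indiff (A <| p |> C) B.

Fact temporal_weight_ge0 (c : {i01 R}) : 0 <= 1 / (c%:num + 1).
Proof. by []. Qed.

Fact temporal_weight_le1 (c : {i01 R}) : 1 / (c%:num + 1) <= 1.
Proof. by rewrite ler_pdivrMr ?ltr_wpDl// mul1r lerDr. Qed.

Definition temporal_weight (c : {i01 R}) : {i01 R} :=
  Itv01 (temporal_weight_ge0 c) (temporal_weight_le1 c).

Lemma temporal_weightE (c : {i01 R}) :
  (temporal_weight c)%:num = 1 / (c%:num + 1).
Proof. by []. Qed.

Lemma onem_temporal_weight (c : {i01 R}) :
  1 - (temporal_weight c)%:num = c%:num / (c%:num + 1).
Proof.
have c1 : c%:num + 1 != 0 by rewrite gt_eqF// ltr_wpDl.
by rewrite temporal_weightE -{1}(divff c1) -mulrBl addrK.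
Qed.

(* By onem_temporal_weight, the second weight is gamma t / (gamma t + 1). *)
Definition temporal_indifference (gamma : T -> {i01 R}) : Prop :=
  forall (A B : lottery) (t : T),
    indiff (prepend [:: t] A <| temporal_weight (gamma t) |> B)
           (prepend [:: t] B <| temporal_weight (gamma t) |> A).

Definition additivity : Prop :=
  forall (h1 h2 : history) (A B C D : lottery) (p : {i01 R}),
    pref (prepend h1 A <| p |> C) (prepend h1 B <| p |> D) <->
    pref (prepend h2 A <| p |> C) (prepend h2 B <| p |> D).

End Preferences.

(* Main.v *)
(** Write X, Y for the two mixtures of the Additivity axiom with prefix t, and
    X', Y' for the same mixtures without prefix.  Temporal indifference, mixed
    with (C + D) / 2, says (X + Y') / 2 ~ (Y + X') / 2.  Hence, by
    Independence, X is preferred to Y iff X' is preferred to Y'; no utility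
    function is needed.  Conversely, Additivity for the prefixes t and
    the empty history, applied to p = 1/2, C = B and D = A, reduces temporal
    indifference to the reflexivity of the preference. *)

Require Import Defs.
From mathcomp Require Import all_boot all_order all_algebra finmap.
From mathcomp Require Import interval_inference reals convex.
From mathcomp Require Import ring lra.

Import Order.TTheory GRing.Theory Num.Theory.

Local Open Scope ring_scope.
Local Open Scope convex_scope.

Lemma fdist_map_id (R : realType) (H : choiceType) (A : fdist R H) :
  fdist_map id A = A.
Proof.
apply/fdistP => y; rewrite fdist_mapE big_mkcond/=.
case: (finsuppP A y) => [yA|yA].
  rewrite big_seq big1// => x xA; case: eqP => // xy.
  by move: yA; rewrite -xy xA.
rewrite (bigD1_seq y)//= eqxx big1 ?addr0// => x /negPf xy.
by rewrite xy.
Qed.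

Lemma fdist_map_comp (R : realType) (H K L : choiceType) (f : H -> K)
    (g : K -> L) (A : fdist R H) :
  fdist_map g (fdist_map f A) = fdist_map (g \o f) A.
Proof.
apply/fdistP => z; rewrite !fdist_mapE big_mkcond [RHS]big_mkcond/=.
rewrite (partition_big_imfset _ f)/=.
(* Both sums now run over the image of the support of [A]; the added points have mass zero under
   [fdist_map f A]. *)
rewrite (@big_fset_incl _ _ _ _ _ [fset f x | x in finsupp A]%fset); first last.
- by move=> y _ yA; case: ifP => // _; exact: fsfun_dflt.
- exact: finsupp_sub.
apply: eq_bigr => y _; rewrite fdist_mapE.
case: ifPn => gyz; last by rewrite big1// => x /eqP->; rewrite (negPf gyz).
by apply: eq_bigr => x /eqP->; rewrite gyz.
Qed.

Lemma prepend_nil (R : realType) (T : countType) (A : fdist R (seq T)) :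
  prepend [::] A = A.
Proof. exact: fdist_map_id. Qed.

Lemma prepend_cat (R : realType) (T : countType) (g h : seq T)
    (A : fdist R (seq T)) :
  prepend (g ++ h) A = prepend g (prepend h A).
Proof.
rewrite /prepend fdist_map_comp; apply/fdistP => z; rewrite !fdist_mapE.
by apply: eq_bigl => x /=; rewrite catA.
Qed.

(** Each of [A], [B], [C], [D] gets the same product of weights on both sides. *)
Lemma fdist_convACA (R : realType) (H : choiceType) (p q : {i01 R})
    (A B C D : fdist R H) :
  (A <| p |> B) <| q |> (C <| p |> D) = (A <| q |> C) <| p |> (B <| q |> D).
Proof. by apply/fdistP => x; rewrite !fdist_convE; ring. Qed.

Lemma temporal_weight1 (R : realType) :
  (temporal_weight (1%:i01 : {i01 R}))%:num = 2^-1.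
Proof. by rewrite temporal_weightE/= div1r. Qed.

Lemma conv_halfC (R : realType) (H : choiceType) (A B : fdist R H) :
  A <| temporal_weight 1%:i01 |> B = B <| temporal_weight 1%:i01 |> A.
Proof. by apply/fdistP => x; rewrite !fdist_convE temporal_weight1; field. Qed.

Section TemporalIndifference.
Context {R : realType} {T : countType}.
Context {pref : fdist R (seq T) -> fdist R (seq T) -> Prop}.
Implicit Types (A B C D X Y Z : fdist R (seq T)) (p : {i01 R}).

Local Notation half := (temporal_weight (1%:i01 : {i01 R})).

Lemma pref_refl A : completeness pref -> pref A A.
Proof. by move=> compl; case: (compl A A). Qed.

Lemma pref_half X Y Z : independence pref ->
  pref X Y <-> pref (X <| half |> Z) (Y <| half |> Z).
Proof. by move=> indep; apply: indep; rewrite temporal_weight1; lra. Qed.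

Lemma indiff_mix X Y Z p : completeness pref -> independence pref ->
  indiff pref X Y -> indiff pref (X <| p |> Z) (Y <| p |> Z).
Proof.
move=> compl indep [XY YX].
(* Independence speaks only of weights strictly between 0 and 1, so the endpoints are treated
   apart. *)
have [p0|p0] := eqVneq p%:num 0.
  have mixZ W : W <| p |> Z = Z.
    by apply/fdistP => x; rewrite fdist_convE p0 mul0r add0r subr0 mul1r.
  by rewrite !mixZ; split; exact: pref_refl.
have [p1|p1] := eqVneq p%:num 1.
  have mixZ W : W <| p |> Z = W.
    by apply/fdistP => x; rewrite fdist_convE p1 subrr mul0r addr0 mul1r.
  by rewrite !mixZ.
have p01 : 0 < p%:num < 1 by rewrite !lt_neqAle p1 eq_sym p0 ge0 le1.
by split; apply: (indep _ _ _ _ p01).1.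
Qed.

(** Both preferences are tested against the even mixture of [Y] and [Y']: mix the first with [Y']
    and the second with [Y]. The left sides thus obtained are indifferent by hypothesis. *)
Lemma pref_cross X Y X' Y' : transitivity pref -> independence pref ->
  indiff pref (X <| half |> Y') (Y <| half |> X') ->
  pref X Y <-> pref X' Y'.
Proof.
move=> trans indep [XY'_YX' YX'_XY']; split => [XY|X'Y'].
- apply: (pref_half _ _ Y indep).2; rewrite ![_ <| half |> Y]conv_halfC.
  by apply: trans YX'_XY' _; apply: (pref_half _ _ _ indep).1.
- apply: (pref_half _ _ Y' indep).2; apply: trans XY'_YX' _.
  by rewrite ![Y <| half |> _]conv_halfC; apply: (pref_half _ _ _ indep).1.
Qed.

Lemma additivity_step (t : T) A B C D p :
  completeness pref -> transitivity pref -> independence pref ->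
  temporal_indifference pref (fun=> 1%:i01) ->
  pref (prepend [:: t] A <| p |> C) (prepend [:: t] B <| p |> D) <->
  pref (A <| p |> C) (B <| p |> D).
Proof.
move=> compl trans indep temp; apply: pref_cross => //.
(* Regrouped, the two sides share the component [C <| half |> D]; their other components are those
   of temporal indifference. *)
rewrite !(fdist_convACA _ _ p half) [D <| half |> C]conv_halfC.
exact/indiff_mix/temp.
Qed.

Lemma additivity_prepend (h : seq T) A B C D p :
  completeness pref -> transitivity pref -> independence pref ->
  temporal_indifference pref (fun=> 1%:i01) ->
  pref (prepend h A <| p |> C) (prepend h B <| p |> D) <->
  pref (A <| p |> C) (B <| p |> D).
Proof.
move=> compl trans indep temp.
elim: h => [|t h IH]; first by rewrite !prepend_nil.
(* The first letter is stripped with [prepend h A] and [prepend h B] in the roles of [A] and [B]. *)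
by rewrite -cat1s !prepend_cat additivity_step.
Qed.

Lemma temporal_indifference_of_additivity :
  completeness pref -> additivity pref ->
  temporal_indifference pref (fun=> 1%:i01).
Proof.
move=> compl add A B t.
by split; apply/(add [:: t] [::]); rewrite !prepend_nil conv_halfC;
  exact: pref_refl.
Qed.

End TemporalIndifference.

Theorem theorem6p2 (R : realType) (T : countType)
    (pref : fdist R (seq T) -> fdist R (seq T) -> Prop) :
  [/\ completeness pref, transitivity pref, independence pref,
      continuity pref & temporal_indifference pref (fun=> 1%:i01)]
  <->
  [/\ completeness pref, transitivity pref, independence pref,
      continuity pref & additivity pref].
Proof.
split=> -[compl trans indep cont ax]; split=> //.
(* Both prefixes reduce to the same prefix-free comparison. *)
- by move=> h1 h2 A B C D p; rewrite !additivity_prepend.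
- exact: temporal_indifference_of_additivity.
Qed.
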